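(* Let $\alpha$ and $\beta$ be positive integers with $1\le\beta\le 3$, and let $n=p_1^{\alpha}p_2^{\beta}p_3p_4$, where $p_i$ is prime for every integer $1\le i\le 4$. Then $n$ is $4$-layered if and only if $p_1=2$, $p_2=3$, $p_3=5$, $p_4=7$, $\alpha\ge 5$, and $\beta=3$.
   Context: A positive integer $n$ is $4$-layered if the set of all positive divisors of $n$ can be partitioned into $4$ subsets having the same sum of elements.
   Formalization: The formal theorem additionally assumes p_3 ≤ p_4, since without an ordering the claim fails for p_1=2, p_2=3, p_3=7, p_4=5, α=5, β=3, where n=30240 is 4-layered. *)

(* Defs.v *)
From mathcomp Require Import all_boot.

Set Implicit Arguments.
Unset Strict Implicit.
Unset Printing Implicit Defensive.

Definition divisor_set (n : nat) : {set 'I_n.+1} :=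
  [set d : 'I_n.+1 | (d : nat) \in divisors n].

(* [partition] also requires the blocks to be nonempty. For [0 < n] and
   [1 < k] this is automatic, since an empty block would force every block
   to have sum 0. *)
Definition layered (k n : nat) : Prop :=
  0 < n /\
  exists P : {set {set 'I_n.+1}},
    [/\ partition P (divisor_set n),
        #|P| = k
      & forall A B : {set 'I_n.+1}, A \in P -> B \in P ->
          \sum_(d in A) (d : nat) = \sum_(d in B) (d : nat)].

(* Main.v *)
Require Import Defs.
From mathcomp Require Import all_boot.
From mathcomp Require Import zify.

(* If n is 4-layered then sigma n >= 4 n, since the block containing n has sum at
   least n. The abundancy sigma n / n is submultiplicative and that of p ^ k is
   less than p / (p - 1), so three primes give less than 2 * 3/2 * 5/4 < 4, and
   with four distinct primes the bound 4 forces 2 ^ a * 3 ^ 3 * 5 * 7 with a >= 5.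
   Conversely 2 ^ 5 * 945 has abundancy exactly 4, and a 4-colouring of its
   divisors is chosen so that it extends from 2 ^ a * 945 to 2 ^ (a + 1) * 945. *)

(** * Divisor sums and colourings of the divisors *)

Definition sigma n := \sum_(d <- divisors n) d.

Lemma divisor_set_sum n (P : pred nat) : 0 < n ->
  \sum_(d in divisor_set n | P d) (d : nat) = \sum_(d <- divisors n | P d) d.
Proof.
move=> n_gt0.
rewrite (eq_bigl (fun d : 'I_n.+1 => ((d : nat) \in divisors n) && P d));
  last by move=> d; rewrite inE.
rewrite -(big_mkord (fun d => (d \in divisors n) && P d) id) -big_filter.
rewrite -[RHS]big_filter; apply: perm_big; apply: uniq_perm.
- by rewrite filter_uniq ?iota_uniq.
- by rewrite filter_uniq ?divisors_uniq.
move=> d; rewrite !mem_filter mem_index_iota /= ltnS -dvdn_divisors //.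
have [dvd_n|] := boolP (d %| n); last by rewrite !andbF.
by rewrite (dvdn_leq n_gt0 dvd_n) andbT andbC.
Qed.

Lemma layered_sigma k n : layered k n -> k * n <= sigma n.
Proof.
case=> n_gt0 [P [partP cardP sumP]].
have n_in : (ord_max : 'I_n.+1) \in cover P.
  by rewrite (cover_partition partP) inE /= divisors_id.
have [A PA nA] := bigcupP n_in.
have leA : n <= \sum_(d in A) (d : nat) by rewrite (bigD1 ord_max) //= leq_addr.
have -> : sigma n = \sum_(d in divisor_set n) (d : nat).
  rewrite /sigma -(divisor_set_sum _ predT) //.
  by apply: eq_bigl => d; rewrite andbT.
have/and3P[_ trivP _] := partP.
rewrite -(cover_partition partP) big_trivIset //= -cardP -sum_nat_const.
by apply: leq_sum => B PB; rewrite (sumP _ _ PB PA).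
Qed.

(** The colour classes are the blocks. As [S] is positive, no class is empty, so distinct colours
    give distinct classes and there are exactly [k] of them. *)
Lemma layered_coloring k n (f : nat -> nat) (S : nat) : 0 < n -> 0 < S ->
  (forall d, d %| n -> f d < k) ->
  (forall c, c < k -> \sum_(d <- divisors n | f d == c) d = S) ->
  layered k n.
Proof.
move=> n_gt0 S_gt0 f_lt sumf; split=> //.
pose blk (c : 'I_k) := [set d in divisor_set n | f d == c].
have sum_blk c : \sum_(d in blk c) (d : nat) = S.
  rewrite -(sumf c (ltn_ord c)) -divisor_set_sum //.
  by apply: eq_bigl => d; rewrite !inE.
have blkP (c : 'I_k) : exists2 d, d \in divisor_set n & f d = c.
  have: blk c != set0.
    by apply: contraTneq S_gt0 => blk0; rewrite -(sum_blk c) blk0 big_set0.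
  by case/set0Pn=> d; rewrite inE => /andP[? /eqP]; exists d.
have blk_inj : injective blk.
  move=> c e eq_ce; have [d dn fd] := blkP c.
  have: d \in blk e by rewrite -eq_ce inE dn fd /=.
  by rewrite inE => /andP[_ /eqP]; rewrite fd => /val_inj.
exists [set blk c | c : 'I_k]; split; last 1 first.
- by move=> _ _ /imsetP[c _ ->] /imsetP[e _ ->]; rewrite !sum_blk.
- apply/and3P; split.
  + apply/eqP/setP=> d; rewrite cover_imset; apply/bigcupP/idP=> [[c _]|dn].
      by rewrite inE => /andP[].
    have fd : f d < k by apply: f_lt; rewrite dvdn_divisors //; rewrite inE in dn.
    by exists (Ordinal fd); rewrite // inE dn /=.
  + apply/trivIsetP => _ _ /imsetP[c _ ->] /imsetP[e _ ->] neq.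
    apply/pred0P=> d; apply/negbTE; apply: contra neq.
    rewrite /= !inE => /andP[/andP[_ /eqP fc] /andP[_ /eqP fe]].
    by apply/eqP; congr blk; apply: val_inj; rewrite /= -fc -fe.
  + apply/imsetP=> -[c _ blk0]; have [d dn fd] := blkP c.
    by have: d \in blk c; [rewrite inE dn fd /= | rewrite -blk0 inE].
- by rewrite card_imset // card_ord.
Qed.

(** * Submultiplicative bounds on the abundancy *)

Lemma dvdn_mul_split d a b : d %| a * b ->
  exists x y, [/\ x %| a, y %| b & d = x * y].
Proof.
case: (posnP d) => [->|d_gt0].
  rewrite dvd0n muln_eq0 => /orP[]/eqP ->.
    by exists 0, b.
  by exists a, 0; rewrite muln0.
(* With [g = gcdn d a], the quotient [d %/ g] is coprime to [a %/ g] and divides [(a %/ g) * b],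
   hence divides [b]. *)
move=> dab; exists (gcdn d a), (d %/ gcdn d a).
have g_gt0 : 0 < gcdn d a by rewrite gcdn_gt0 d_gt0.
split; first exact: dvdn_gcdr.
  rewrite -(@Gauss_dvdr _ (a %/ gcdn d a)).
    rewrite -(@dvdn_pmul2l (gcdn d a)) // mulnC divnK ?dvdn_gcdl //.
    by rewrite mulnA [gcdn d a * _]mulnC divnK ?dvdn_gcdr.
  rewrite /coprime -(eqn_pmul2l g_gt0) muln_gcdr ![gcdn d a * (_ %/ _)]mulnC.
  by rewrite !divnK ?dvdn_gcdl ?dvdn_gcdr ?muln1.
by rewrite mulnC divnK ?dvdn_gcdl.
Qed.

Lemma leq_sum_seq (s t : seq nat) : uniq s -> {subset s <= t} ->
  \sum_(x <- s) x <= \sum_(x <- t) x.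
Proof.
move=> us st.
have := @uniq_sub_le_big _ _ leq leqnn (fun x y => leq_addr y x) 0 _ s (undup t)
  xpredT id us (undup_uniq t).
move=> /(_ _)/leq_trans; apply; first by move=> x /st; rewrite mem_undup.
elim: t {us st} => //= x t IH.
case: ifP => _; rewrite !big_cons; last by rewrite leq_add2l.
exact: leq_trans IH (leq_addl _ _).
Qed.

(** Every divisor of [a * b] is a product of a divisor of [a] and one of [b]. Without coprimality
    such a product may occur several times, hence only an inequality. *)
Lemma sigmaM a b : 0 < a -> 0 < b -> sigma (a * b) <= sigma a * sigma b.
Proof.
move=> a_gt0 b_gt0.
have -> : sigma a * sigma b =
    \sum_(d <- [seq x * y | x <- divisors a, y <- divisors b]) d.
  rewrite big_allpairs_dep /= big_distrl /=.
  by apply: eq_bigr => x _; rewrite big_distrr.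
apply: leq_sum_seq (divisors_uniq _) _ => d.
rewrite -dvdn_divisors ?muln_gt0 ?a_gt0 // => /dvdn_mul_split[x [y [xa yb ->]]].
by apply/allpairsP; exists (x, y); rewrite /= -!dvdn_divisors.
Qed.

(* [sigma n / n <= c / d] *)
Definition abundancy_le c d n := (0 < n) && (d * sigma n <= c * n).

Lemma abundancy_leM c d c' d' a b :
  abundancy_le c d a -> abundancy_le c' d' b ->
  abundancy_le (c * c') (d * d') (a * b).
Proof.
case/andP=> a_gt0 la /andP[b_gt0 lb]; rewrite /abundancy_le muln_gt0 a_gt0 b_gt0.
have := leq_mul la lb; rewrite mulnACA [c * a * _]mulnACA; apply: leq_trans.
by rewrite leq_mul2l sigmaM ?orbT.
Qed.

Lemma sigma_pfactor p k : prime p -> p.-1 * sigma (p ^ k) = (p ^ k.+1).-1.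
Proof.
move=> p_pr; rewrite predn_exp; congr (_ * _).
rewrite -(big_mkord xpredT) /sigma -(big_map (expn p) xpredT id).
apply: perm_big; apply: uniq_perm.
- exact: divisors_uniq.
- by rewrite map_inj_uniq ?iota_uniq //; apply: expnI; exact: prime_gt1.
move=> d; rewrite -dvdn_divisors ?expn_gt0 ?prime_gt0 //.
apply/dvdn_pfactor/mapP => // -[m lem ->]; exists m => //.
  by rewrite mem_index_iota.
by rewrite mem_index_iota in lem.
Qed.

(** By the geometric sum, the abundancy is below [p / p.-1], which decreases as [p] grows. *)
Lemma abundancy_pfactor r p k : prime p -> 1 < r <= p ->
  abundancy_le r r.-1 (p ^ k).
Proof.
move=> p_pr /andP[r_gt1 lerp]; have p_gt1 := prime_gt1 p_pr.
rewrite /abundancy_le expn_gt0 prime_gt0 //=.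
rewrite -(@leq_pmul2l p.-1); last lia.
rewrite mulnCA sigma_pfactor // expnS.
have := expn_gt0 p k; nia.
Qed.

Lemma abundancy_prime r p : prime p -> 0 < r <= p -> abundancy_le r.+1 r p.
Proof.
move=> p_pr lerp; have p_gt1 := prime_gt1 p_pr.
have := sigma_pfactor p 1 p_pr; rewrite /abundancy_le expn1.
nia.
Qed.

Lemma abundancy_lt4 c d n : abundancy_le c d n -> c < 4 * d -> sigma n < 4 * n.
Proof. by case/andP; rewrite /sigma; nia. Qed.

(* Rounding a prime down to one of 2, 3, 5, 7 only increases [p / p.-1]. *)
Lemma prime_round p : prime p ->
  exists2 r, r \in [:: 2; 3; 5; 7] & r <= p /\ (r < 7 -> p = r).
Proof.
move=> p_pr; case: (ltnP p 7) => [p_lt7|]; last by exists 7.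
by exists p => //; do 7?[case: p p_pr p_lt7 => // p p_pr p_lt7].
Qed.

(** * Necessity: keeping the abundancy below 4 *)

Lemma sigma_two_primes p q a b : prime p -> prime q ->
  sigma (p ^ a * q ^ b) < 4 * (p ^ a * q ^ b).
Proof.
move=> p_pr q_pr; have [p_gt1 q_gt1] := (prime_gt1 p_pr, prime_gt1 q_pr).
wlog le_pq : p q a b p_pr q_pr p_gt1 q_gt1 / p <= q.
  by move=> IH; case/orP: (leq_total p q) => ?; [|rewrite mulnC]; apply: IH.
move: le_pq; rewrite leq_eqVlt => /predU1P[<-|lt_pq].
  by rewrite -expnD; apply: (@abundancy_lt4 2 1) => //; apply: abundancy_pfactor.
(* Here [2 <= p] and [3 <= q], so the abundancy is at most 2 * 3/2 = 3. *)
apply: (@abundancy_lt4 (2 * 3) (1 * 2)) => //.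
by apply: abundancy_leM; apply: abundancy_pfactor => //=; lia.
Qed.

Lemma sigma_three_primes p q s a b c : prime p -> prime q -> prime s ->
  sigma (p ^ a * q ^ b * s ^ c) < 4 * (p ^ a * q ^ b * s ^ c).
Proof.
move=> p_pr q_pr s_pr.
have [<-|neq_pq] := eqVneq p q; first by rewrite -expnD sigma_two_primes.
have [<-|neq_ps] := eqVneq p s; first by rewrite mulnAC -expnD sigma_two_primes.
have [<-|neq_qs] := eqVneq q s; first by rewrite -mulnA -expnD sigma_two_primes.
have [r1 r1_in [le1 eq1]] := prime_round _ p_pr.
have [r2 r2_in [le2 eq2]] := prime_round _ q_pr.
have [r3 r3_in [le3 eq3]] := prime_round _ s_pr.
apply: (@abundancy_lt4 (r1 * r2 * r3) (r1.-1 * r2.-1 * r3.-1)).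
  have gt1 r : r \in [:: 2; 3; 5; 7] -> 1 < r by rewrite !inE => /or4P[]/eqP->.
  by do 2?apply: abundancy_leM; apply: abundancy_pfactor => //; rewrite gt1.
(* Rounded values below 7 are the primes themselves, so they cannot repeat; the worst case is 2 *
   3/2 * 5/4 = 15/4. *)
move: neq_pq neq_ps neq_qs.
move: r1_in r2_in r3_in le1 le2 le3 eq1 eq2 eq3; rewrite !inE.
by do 3![case/or4P => /eqP->]; lia.
Qed.

(* An upper bound [(c, d)], read [c / d], for the abundancy of [p ^ b] with
   [b <= 3] and [p] rounded down to [r]. For [r = 2] and [r = 3] it is the
   abundancy of [r ^ 3]; the cruder [r / r.-1] would not exclude cases such as
   [p1 = 3], [p2 = 2]. *)
Definition pfactor3_bound r :=
  if r == 2 then (15, 8) else if r == 3 then (40, 27) else (r, r.-1).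

Lemma abundancy_pfactor3 r p b : prime p -> 0 < b <= 3 ->
  r \in [:: 2; 3; 5; 7] -> r <= p -> (r < 7 -> p = r) ->
  abundancy_le (pfactor3_bound r).1 (pfactor3_bound r).2 (p ^ b).
Proof.
move=> p_pr /andP[b_gt0 b_le3]; rewrite !inE => /or4P[]/eqP-> le eq.
- rewrite eq // /abundancy_le /sigma -sumnE.
  by case: b b_gt0 b_le3 => [|[|[|[|]]]].
- rewrite eq // /abundancy_le /sigma -sumnE.
  by case: b b_gt0 b_le3 => [|[|[|[|]]]].
- exact: abundancy_pfactor.
- exact: abundancy_pfactor.
Qed.

Lemma four_primes_shape p1 p2 p3 p4 a b :
  prime p1 -> prime p2 -> prime p3 -> prime p4 -> 0 < b <= 3 -> p3 <= p4 ->
  let n := p1 ^ a * p2 ^ b * p3 * p4 in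
  4 * n <= sigma n -> [/\ p1 = 2, p2 = 3, p3 = 5 & 7 <= p4].
Proof.
move=> p1_pr p2_pr p3_pr p4_pr b_bd le34 n; rewrite leqNgt => /negP n_ab.
(* If two of the four primes coincide, [n] is a product of three prime powers, too few to reach
   abundancy 4. *)
have three q1 q2 q3 e1 e2 e3 : prime q1 -> prime q2 -> prime q3 ->
    n <> q1 ^ e1 * q2 ^ e2 * q3 ^ e3.
  by move=> ? ? ? n_eq; apply: n_ab; rewrite n_eq sigma_three_primes.
have neq12 : p1 <> p2.
  by move=> eq; apply: (@three p2 p3 p4 (a + b) 1 1) => //; rewrite /n eq expnD.
have neq13 : p1 <> p3.
  by move=> eq; apply: (@three p3 p2 p4 a.+1 b 1) => //; rewrite /n eq expnS; lia.
have neq14 : p1 <> p4.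
  by move=> eq; apply: (@three p4 p2 p3 a.+1 b 1) => //; rewrite /n eq expnS; lia.
have neq23 : p2 <> p3.
  by move=> eq; apply: (@three p3 p1 p4 b.+1 a 1) => //; rewrite /n eq expnS; lia.
have neq24 : p2 <> p4.
  by move=> eq; apply: (@three p4 p1 p3 b.+1 a 1) => //; rewrite /n eq expnS; lia.
have neq34 : p3 <> p4.
  by move=> eq; apply: (@three p1 p2 p4 a b 2) => //; rewrite /n eq -mulnA.
have [r1 r1_in [le1 eq1]] := prime_round _ p1_pr.
have [r2 r2_in [le2 eq2]] := prime_round _ p2_pr.
have [r3 r3_in [le3 eq3]] := prime_round _ p3_pr.
have [r4 r4_in [le4 eq4]] := prime_round _ p4_pr.
have gt1 r : r \in [:: 2; 3; 5; 7] -> 1 < r by rewrite !inE => /or4P[]/eqP->.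
have n_le : abundancy_le (r1 * (pfactor3_bound r2).1 * r3.+1 * r4.+1)
                         (r1.-1 * (pfactor3_bound r2).2 * r3 * r4) n.
  do 3?apply: abundancy_leM.
  - by apply: abundancy_pfactor; rewrite ?gt1.
  - exact: abundancy_pfactor3.
  - by apply: abundancy_prime; rewrite // ltnW ?gt1.
  - by apply: abundancy_prime; rewrite // ltnW ?gt1.
have: ~~ (r1 * (pfactor3_bound r2).1 * r3.+1 * r4.+1 <
          4 * (r1.-1 * (pfactor3_bound r2).2 * r3 * r4)).
  by apply/negP => /(abundancy_lt4 _ _ _ n_le).
clear n_le n_ab three gt1.
move: r1_in r2_in r3_in r4_in le1 le2 le3 le4 eq1 eq2 eq3 eq4; rewrite !inE.
(* Of the 256 rounded quadruples, computation discards those with bound below 4. The others repeat a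
   prime below 7, contradict [p3 <= p4], or are (2, 3, 5, 7), where the last entry only says
   [7 <= p4]. *)
do 4![case/or4P => /eqP->]; try (by vm_compute);
  by rewrite /pfactor3_bound /= => *; first [exfalso; lia | split; lia].
Qed.

Lemma four_primes_abundant p1 p2 p3 p4 a b :
  prime p1 -> prime p2 -> prime p3 -> prime p4 -> 0 < b <= 3 -> p3 <= p4 ->
  let n := p1 ^ a * p2 ^ b * p3 * p4 in
  4 * n <= sigma n ->
  [/\ p1 = 2, p2 = 3, p3 = 5 & p4 = 7] /\ 5 <= a /\ b = 3.
Proof.
move=> p1_pr p2_pr p3_pr p4_pr b_bd le34 n n_ab.
have [e1 e2 e3 p4_ge7] :=
  four_primes_shape _ _ _ _ a _ p1_pr p2_pr p3_pr p4_pr b_bd le34 n_ab.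
move: n_ab; rewrite /n {n}; subst p1 p2 p3; rewrite leqNgt => /negP n_ab.
have ab2 : abundancy_le 2 1 (2 ^ a) by apply: abundancy_pfactor.
have ab5 : abundancy_le 6 5 5 by apply: abundancy_prime.
have ab4 : abundancy_le 8 7 p4 by apply: abundancy_prime.
have ab3 : abundancy_le 40 27 (3 ^ b).
  case/andP: b_bd {n_ab} => b_gt0 b_le3; rewrite /abundancy_le /sigma -sumnE.
  by case: b b_gt0 b_le3 => [|[|[|[|]]]].
have bound c d c' d' c4 d4 :
    abundancy_le c d (2 ^ a) -> abundancy_le c' d' (3 ^ b) ->
    abundancy_le c4 d4 p4 -> ~~ (c * c' * 6 * c4 < 4 * (d * d' * 5 * d4)).
  move=> le2 le3 le4; apply/negP; apply: contra_not n_ab.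
  by apply: abundancy_lt4; do !apply: abundancy_leM.
(* For [b <= 2] the factor 40/27 drops to 13/9, and 2 * 13/9 * 6/5 * 8/7 < 4. *)
have b3 : b = 3.
  apply/eqP; rewrite eqn_leq; case/andP: b_bd => b_gt0 -> /=; rewrite ltnNge.
  apply/negP => b_le2; suff ab3' : abundancy_le 13 9 (3 ^ b).
    by have := bound _ _ _ _ _ _ ab2 ab3' ab4.
  rewrite /abundancy_le /sigma -sumnE.
  by case: b b_gt0 b_le2 {ab3 n_ab bound} => [|[|[|]]].
(* The next prime is 11, and 2 * 40/27 * 6/5 * 12/11 < 4. *)
have p4_eq7 : p4 = 7.
  apply/eqP/negPn/negP => p4_neq7.
  have ab11 : abundancy_le 12 11 p4.
    apply: abundancy_prime => //=; rewrite ltnNge.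
    apply: contra p4_neq7 => p4_le10; move: p4_pr.
    by move: p4_le10 p4_ge7; clear; do 11?[case: p4 => // p4].
  by have := bound _ _ _ _ _ _ ab2 ab3 ab11.
split=> //; split=> //; rewrite ltnNge; apply/negP => a_le4.
(* 31/16 is the abundancy of [2 ^ 4], and 31/16 * 40/27 * 6/5 * 8/7 < 4. *)
have ab2' : abundancy_le 31 16 (2 ^ a).
  rewrite /abundancy_le /sigma -sumnE.
  by case: a a_le4 {ab2 n_ab bound} => [|[|[|[|[|]]]]].
by have := bound _ _ _ _ _ _ ab2' ab3 ab4.
Qed.

(** * Sufficiency: extending a colouring to higher powers of 2 *)

Lemma pow2S_ndvd m a d : odd m -> d %| 2 ^ a * m -> (2 ^ a.+1 %| d) = false.
Proof.
move=> m_odd d_dvd; apply/negP => /dvdn_trans/(_ d_dvd).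
by rewrite Gauss_dvdl ?dvdn_Pexp2l ?ltnn // coprimeXl // coprime2n.
Qed.

Lemma divisors_pow2S m a (F : nat -> nat) : odd m ->
  \sum_(d <- divisors (2 ^ a.+1 * m)) F d =
  \sum_(d <- divisors (2 ^ a * m)) F d +
  \sum_(e <- divisors m) F (2 ^ a.+1 * e).
Proof.
move=> m_odd; have m_gt0 := odd_gt0 m_odd.
have pow_gt0 b : 0 < 2 ^ b * m by rewrite muln_gt0 expn_gt0.
rewrite -(big_map (muln (2 ^ a.+1)) xpredT F) -big_cat; apply: perm_big.
apply: uniq_perm; first exact: divisors_uniq.
  rewrite cat_uniq divisors_uniq map_inj_uniq ?divisors_uniq ?andbT /=; last first.
    by move=> x y /eqP; rewrite eqn_pmul2l ?expn_gt0 // => /eqP.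
  apply/hasPn => _ /mapP[e _ ->]; rewrite -dvdn_divisors //.
  by apply/negP => /(pow2S_ndvd _ _ _ m_odd); rewrite dvdn_mulr.
move=> d; rewrite mem_cat -!dvdn_divisors //; apply/idP/orP.
  move=> /dvdn_mul_split[x [y [/dvdn_pfactor -/(_ isT)[b]]]].
  rewrite leq_eqVlt => /predU1P[->|lt_ba] -> ym ->.
    by right; apply: map_f; rewrite -dvdn_divisors.
  by left; apply: dvdn_mul; rewrite // dvdn_exp2l.
case=> [/dvdn_trans|/mapP[e em ->]].
  by apply; rewrite dvdn_mul // dvdn_exp2l.
by rewrite dvdn_pmul2l ?expn_gt0 // dvdn_divisors.
Qed.

Lemma eq_sum_filter (s : seq nat) (P Q : pred nat) (F : nat -> nat) :
  {in s, P =1 Q} -> \sum_(d <- s | P d) F d = \sum_(d <- s | Q d) F d.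
Proof.
by move=> eqPQ; rewrite -big_filter (eq_in_filter eqPQ) big_filter.
Qed.

(* Write a divisor of [2 ^ a * m] as [2 ^ i * e] with [e %| m]. Level [i = a] is
   coloured by [top], the levels [l < i < a] by [mid], and the divisors of
   [2 ^ l * m] by [base]. As [mid] and [top] have complementary colour sums,
   raising [a] by one, which turns the old top level into a [mid] level, keeps
   the colours balanced. *)
Section LevelColoring.

Variables (k m l T : nat) (base mid top : nat -> nat).
Hypotheses (m_odd : odd m) (T_gt0 : 0 < T).
Hypothesis base_lt : forall d, base d < k.
Hypothesis mid_lt : forall e, mid e < k.
Hypothesis top_lt : forall e, top e < k.
(** Summing over the colours shows that [T] is [sigma m / k]; the right-hand side is then
    [sigma (2 ^ l.+1 * m) / k]. *)
Hypothesis base_top_sum : forall c, c < k ->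
  \sum_(d <- divisors (2 ^ l * m) | base d == c) d +
  2 ^ l.+1 * \sum_(e <- divisors m | top e == c) e = T * (2 ^ l.+2 - 1).
Hypothesis mid_top_sum : forall c, c < k ->
  \sum_(e <- divisors m | mid e == c) e +
  \sum_(e <- divisors m | top e == c) e = T * 2.

Let lower_color d :=
  if 2 ^ l.+1 %| d then mid (d %/ 2 ^ logn 2 d) else base d.

Let color a d := if 2 ^ a %| d then top (d %/ 2 ^ a) else lower_color d.

Let lower_color_sum a c : c < k ->
  \sum_(d <- divisors (2 ^ (a + l) * m) | lower_color d == c) d +
  2 ^ (a + l).+1 * \sum_(e <- divisors m | top e == c) e =
  T * (2 ^ (a + l).+2 - 1).
Proof.
have m_gt0 := odd_gt0 m_odd.
move=> c_lt; elim: a => [|a IH].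
  rewrite add0n -(base_top_sum _ c_lt); congr (_ + _).
  apply: eq_sum_filter => d; rewrite -dvdn_divisors ?muln_gt0 ?expn_gt0 //.
  by move=> /(pow2S_ndvd _ _ _ m_odd) nd; rewrite /lower_color nd.
rewrite big_mkcond addSn divisors_pow2S // -!big_mkcond /=.
have -> : \sum_(e <- divisors m | lower_color (2 ^ (a + l).+1 * e) == c)
    2 ^ (a + l).+1 * e =
    2 ^ (a + l).+1 * \sum_(e <- divisors m | mid e == c) e.
  rewrite big_distrr /=; apply: eq_sum_filter => e.
  rewrite -dvdn_divisors // => e_dvd; have e_odd := dvdn_odd e_dvd m_odd.
  rewrite /lower_color dvdn_mulr; last by rewrite dvdn_exp2l // ltnS leq_addl.
  have e_gt0 := odd_gt0 e_odd; rewrite lognM ?expn_gt0 //.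
  rewrite pfactorK // (logn_coprime _) ?coprime2n //.
  by rewrite addn0 mulKn // expn_gt0.
(* With [u] and [t] the [mid] and [top] sums of colour [c], the left side grows by [2 ^ (a + l).+1 *
   (u + t) = T * 2 ^ (a + l).+2], which is also the growth of the right side. *)
have := mid_top_sum _ c_lt; have := expn_gt0 2 (a + l); move: IH.
by rewrite !expnS; nia.
Qed.

Lemma layered_pow2 a : l < a -> layered k (2 ^ a * m).
Proof.
have m_gt0 := odd_gt0 m_odd.
move=> lt_la; rewrite -(subnK lt_la) addnS; move: (a - l.+1) => b.
apply: (@layered_coloring k _ (color (b + l).+1) (T * (2 ^ (b + l).+2 - 1))).
- by rewrite muln_gt0 expn_gt0.
- by rewrite muln_gt0 T_gt0 subn_gt0 -[1]/(2 ^ 0) ltn_exp2l.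
- by move=> d _; rewrite /color /lower_color; do ![case: ifP => _].
move=> c c_lt; rewrite -(lower_color_sum _ _ c_lt) big_mkcond.
rewrite divisors_pow2S // -!big_mkcond /= big_distrr /=.
congr (_ + _); apply: eq_sum_filter => d;
  rewrite -dvdn_divisors ?muln_gt0 ?expn_gt0 // => d_dvd.
  by rewrite /color (pow2S_ndvd _ _ _ m_odd d_dvd).
by rewrite /color dvdn_mulr // mulKn ?expn_gt0.
Qed.

End LevelColoring.

(* For [a = 5] the target sum is [30240 = 2 ^ 5 * 945], so [2 ^ 5 * 945] is alone
   in colour 0. Then colour 1 at the top level can be [15], with the remaining
   divisors of 945 split as 480 + 480; exchanging 945 and 15 gives [mid_color].
   The divisors of [2 ^ 4 * 945] must then be split as 29760 + 14880 + 14880. *)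
Definition base_color d :=
  if d \in [:: 7560; 5040; 2160; 120] then 2
  else if d \in [:: 3780; 3024; 2520; 1890; 1680; 1512; 432; 42] then 3
  else 1.

Definition half_color e := if e \in [:: 3; 27; 135; 315] then 2 else 3.

Definition top_color e :=
  if e == 945 then 0 else if e == 15 then 1 else half_color e.

Definition mid_color e :=
  if e == 15 then 0 else if e == 945 then 1 else half_color e.

Lemma sum_filter_sumn (s : seq nat) (P : pred nat) :
  \sum_(d <- s | P d) d = sumn [seq d <- s | P d].
Proof. by rewrite sumnE big_filter. Qed.

Lemma layered_pow2_945 a : 5 <= a -> layered 4 (2 ^ a * 945).
Proof.
(* 480 is a quarter of [sigma 945 = 1920]; the level [l = 4] makes [a = 5] the first case. *)
apply: (@layered_pow2 4 945 4 480 base_color mid_color top_color).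
- by [].
- by [].
- by move=> d; rewrite /base_color; do ![case: ifP => _].
- by move=> e; rewrite /mid_color /half_color; do ![case: ifP => _].
- by move=> e; rewrite /top_color /half_color; do ![case: ifP => _].
- move=> c c_lt; rewrite 2!sum_filter_sumn; apply/eqP; move: c c_lt.
  have /allP check : all (fun c =>
      sumn [seq d <- divisors (2 ^ 4 * 945) | base_color d == c] +
      2 ^ 5 * sumn [seq e <- divisors 945 | top_color e == c]
        == 480 * (2 ^ 6 - 1)) (iota 0 4) by vm_compute.
  by move=> c c_lt; apply: check; rewrite mem_iota.
- move=> c c_lt; rewrite 2!sum_filter_sumn; apply/eqP; move: c c_lt.
  have /allP check : all (fun c =>
      sumn [seq e <- divisors 945 | mid_color e == c] +
      sumn [seq e <- divisors 945 | top_color e == c] == 480 * 2)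
    (iota 0 4) by vm_compute.
  by move=> c c_lt; apply: check; rewrite mem_iota.
Qed.

(* p3 and p4 play symmetric roles in n, so the conclusion p3 = 5, p4 = 7
   presupposes that they are labelled in increasing order. *)
Theorem theorem5p28 (alpha beta p1 p2 p3 p4 n : nat)
  (alpha_gt0 : 0 < alpha) (beta_bounds : 1 <= beta <= 3)
  (p1_prime : prime p1) (p2_prime : prime p2)
  (p3_prime : prime p3) (p4_prime : prime p4)
  (p34 : p3 <= p4)
  (n_eq : n = p1 ^ alpha * p2 ^ beta * p3 * p4) :
  layered 4 n <->
  [/\ p1 = 2, p2 = 3, p3 = 5 & p4 = 7] /\ 5 <= alpha /\ beta = 3.
Proof.
rewrite n_eq; split=> [/layered_sigma|[[-> -> -> ->] [a_ge5 ->]]].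
  exact: four_primes_abundant.
by rewrite -!mulnA; apply: layered_pow2_945.
Qed.
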